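(* Let $r,s\ge1$ be integers. Then the pseudo $H$-type Lie algebra $\mathfrak n_{r,s}=\mathfrak v_{r,s}\oplus\mathfrak z_{r,s}$ does not have the strongly bracket generating property: it is not true that for every non-zero $v\in\mathfrak v_{r,s}$ the linear map $\mathrm{ad}_v=[v,\cdot\,]:\mathfrak v_{r,s}\to\mathfrak z_{r,s}$ is surjective.
   Context: For integers $r,s\ge 0$ with $r+s\ge1$, $\mathbb R^{r,s}$ is $\mathbb R^{r+s}$ with $\langle Z,W\rangle_{r,s}=\sum_{i=1}^r Z_iW_i-\sum_{j=r+1}^{r+s}Z_jW_j$, and $\mathrm{Cl}_{r,s}$ is the real unital associative algebra generated by $\mathbb R^{r,s}$ subject to $Z\otimes Z=-\langle Z,Z\rangle_{r,s}\,1$. A scalar product is a non-degenerate (possibly indefinite) symmetric bilinear form. An admissible $\mathrm{Cl}_{r,s}$-module is a non-zero finite-dimensional real vector space $\mathfrak v$ with a representation $J:\mathrm{Cl}_{r,s}\to\mathrm{End}(\mathfrak v)$ and a scalar product $\langle\cdot,\cdot\rangle_{\mathfrak v}$ such that $\langle J_Zv,w\rangle_{\mathfrak v}=-\langle v,J_Zw\rangle_{\mathfrak v}$ for all $Z\in\mathbb R^{r,s}$, $v,w\in\mathfrak v$. It is minimal if its dimension is minimal among admissible $\mathrm{Cl}_{r,s}$-modules. The associated pseudo $H$-type Lie algebra is $\mathfrak n=\mathfrak v\oplus\mathbb R^{r,s}$ (orthogonal sum), with center $\mathbb R^{r,s}$ and bracket $[\cdot,\cdot]:\mathfrak v\times\mathfrak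 v\to\mathbb R^{r,s}$ determined by $\langle J_Zv,w\rangle_{\mathfrak v}=\langle Z,[v,w]\rangle_{r,s}$ for all $Z\in\mathbb R^{r,s}$, $v,w\in\mathfrak v$. The notation $\mathfrak n_{r,s}=\mathfrak v_{r,s}\oplus\mathfrak z_{r,s}$, $\mathfrak z_{r,s}=\mathbb R^{r,s}$, stands for the pseudo $H$-type Lie algebra built from a minimal admissible module $\mathfrak v_{r,s}$. *)

(* Defs.v *)
From HB Require Import structures.
From mathcomp Require Import all_boot all_order all_algebra sesquilinear.
From mathcomp Require Import reals.

Set Implicit Arguments.
Unset Strict Implicit.
Unset Printing Implicit Defensive.

Import Order.TTheory GRing.Theory Num.Theory.
Local Open Scope ring_scope.

(* The scalar product of signature (r, s) on R^(r + s); the first r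
   coordinates are the positive ones. *)
Definition prs (R : realType) (r s : nat) (Z W : 'rV[R]_(r + s)) : R :=
  \sum_(i < r) Z 0 (lshift s i) * W 0 (lshift s i)
  - \sum_(j < s) Z 0 (rshift r j) * W 0 (rshift r j).

Definition clifford_map (R : realType) (r s : nat) (A : algType R)
    (f : {linear 'rV[R]_(r + s) -> A}) : Prop :=
  forall Z, f Z * f Z = (- prs Z Z)%:A.

(* (A, iota) is the real unital associative algebra generated by R^{r,s}
   subject to Z * Z = - <Z, Z>_{r,s} 1: the presentation is expressed by its
   universal property, which determines (A, iota) up to unique isomorphism. *)
Definition clifford_algebra (R : realType) (r s : nat) (A : algType R)
    (iota : {linear 'rV[R]_(r + s) -> A}) : Prop :=
  clifford_map iota /\
  forall (B : algType R) (f : {linear 'rV[R]_(r + s) -> B}), clifford_map f ->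
    exists g : {lrmorphism A -> B},
      (forall Z, g (iota Z) = f Z) /\
      (forall h : {lrmorphism A -> B},
         (forall Z, h (iota Z) = f Z) -> h =1 g).

(* MathComp has no canonical ring structure on 'End(V), so an algebra morphism
   into 'End(V) is a linear map that is also unital and multiplicative. *)
Definition representation (R : realType) (A : algType R) (V : vectType R)
    (J : {linear A -> 'End(V)}) : Prop :=
  J 1 = \1%VF /\ forall a b, J (a * b) = (J a \o J b)%VF.

Record admissible_module (R : realType) (r s : nat) (A : algType R)
    (iota : {linear 'rV[R]_(r + s) -> A}) := AdmissibleModule {
  am_space :> vectType R;
  am_rep : {linear A -> 'End(am_space)};
  am_form : {symmetric am_space};
  am_nonzero : (0 < \dim {:am_space})%N;
  am_repP : representation am_rep;
  am_nondegenerate : nondegenerate am_form;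
  am_skew : forall (Z : 'rV[R]_(r + s)) (v w : am_space),
    am_form (am_rep (iota Z) v) w = - am_form v (am_rep (iota Z) w)
}.

Definition minimal_admissible (R : realType) (r s : nat) (A : algType R)
    (iota : {linear 'rV[R]_(r + s) -> A}) (M : admissible_module iota) : Prop :=
  forall M' : admissible_module iota, (\dim {:M} <= \dim {:M'})%N.

(* The pseudo H-type Lie algebra structure on M * R^{r,s} is determined by its
   component M x M -> R^{r,s}, the second summand being central: see ph_lie. *)
Record pseudoH_algebra (R : realType) (r s : nat) (A : algType R)
    (iota : {linear 'rV[R]_(r + s) -> A}) (M : admissible_module iota) :=
  PseudoHAlgebra {
  ph_bracket : M -> M -> 'rV[R]_(r + s);
  ph_bracketP : forall (Z : 'rV[R]_(r + s)) (v w : M),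
    am_form M (am_rep M (iota Z) v) w = prs Z (ph_bracket v w)
}.

Definition ph_lie (R : realType) (r s : nat) (A : algType R)
    (iota : {linear 'rV[R]_(r + s) -> A}) (M : admissible_module iota)
    (N : pseudoH_algebra M) (x y : M * 'rV[R]_(r + s)) : M * 'rV[R]_(r + s) :=
  (0, ph_bracket N x.1 y.1).

Definition ph_ad (R : realType) (r s : nat) (A : algType R)
    (iota : {linear 'rV[R]_(r + s) -> A}) (M : admissible_module iota)
    (N : pseudoH_algebra M) (v w : M) : 'rV[R]_(r + s) :=
  (ph_lie N (v, 0) (w, 0)).2.

Definition strongly_bracket_generating (R : realType) (r s : nat)
    (A : algType R) (iota : {linear 'rV[R]_(r + s) -> A})
    (M : admissible_module iota) (N : pseudoH_algebra M) : Prop :=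
  forall v : M, v != 0 -> forall Z, exists w, ph_ad N v w = Z.

Lemma pseudoH_algebra_exists (R : realType) (r s : nat) (A : algType R)
    (iota : {linear 'rV[R]_(r + s) -> A}) (M : admissible_module iota) :
  inhabited (pseudoH_algebra M).
Proof.
pose f v w k := am_form M (am_rep M (iota (delta_mx 0 k)) v) w.
pose b v w : 'rV[R]_(r + s) := row_mx (\row_i f v w (lshift s i))
                                      (\row_j - f v w (rshift r j)).
suff bP Z v w : am_form M (am_rep M (iota Z) v) w = prs Z (b v w).
  by split; exists b.
rewrite {1}[Z]row_sum_delta !linear_sum sum_lfunE linear_sumlz big_split_ord /=.
rewrite /prs -sumrN; congr (_ + _); apply: eq_bigr => i _.
  by rewrite row_mxEl mxE !linearZ/= scale_lfunE linearZl_LR.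
by rewrite row_mxEr mxE mulrN opprK !linearZ/= scale_lfunE linearZl_LR.
Qed.

Lemma ph_bracket_unique (R : realType) (r s : nat) (A : algType R)
    (iota : {linear 'rV[R]_(r + s) -> A}) (M : admissible_module iota)
    (N N' : pseudoH_algebra M) (v w : M) :
  ph_bracket N v w = ph_bracket N' v w.
Proof.
have e Z : prs Z (ph_bracket N v w) = prs Z (ph_bracket N' v w).
  by rewrite -!ph_bracketP.
have prsl i W : prs (delta_mx 0 (lshift s i)) W = W 0 (lshift s i) :> R.
  rewrite /prs (bigD1 i) //= mxE !eqxx mul1r !big1 ?addr0 ?subr0 // => l.
    by rewrite mxE eq_rlshift mul0r.
  by rewrite mxE (inj_eq (@lshift_inj _ _)) => /negPf->; rewrite mul0r.
have prsr j W : prs (delta_mx 0 (rshift r j)) W = - W 0 (rshift r j) :> R.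
  rewrite /prs big1 => [|l _]; last by rewrite mxE eq_lrshift mul0r.
  rewrite (bigD1 j) //= mxE !eqxx mul1r big1 ?addr0 ?sub0r // => l.
  by rewrite mxE (inj_eq (@rshift_inj _ _)) => /negPf->; rewrite mul0r.
apply/rowP => k; rewrite -(splitK k); case: (split k) => [i|j] /=.
  by rewrite -!prsl.
by apply: oppr_inj; rewrite -!prsr.
Qed.

(* Main.v *)
Require Import Defs.
From HB Require Import structures.
From mathcomp Require Import all_boot all_order all_algebra sesquilinear.
From mathcomp Require Import reals.

(** By the defining relation of the bracket, [ad_v] misses a direction as soon
as [J_Z v = 0] for some [Z != 0]: its image is then orthogonal to [Z], and the
scalar product of signature (r, s) is non-degenerate.  When [r] and [s] are
both positive there is a nonzero null vector [Z], namely the sum of a positive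
and a negative basis vector.  The Clifford relation makes [J_Z] square to zero,
so [J_Z] cannot be injective on a nonzero module, and any nonzero [v] in its
kernel refutes surjectivity of [ad_v]. *)

Import GRing.Theory.
Local Open Scope ring_scope.

Definition null_vector (R : realType) (r s : nat) (i : 'I_r) (j : 'I_s) :
    'rV[R]_(r + s) :=
  delta_mx 0 (lshift s i) + delta_mx 0 (rshift r j).

Lemma prs_null_vector (R : realType) (r s : nat) (i : 'I_r) (j : 'I_s)
    (W : 'rV[R]_(r + s)) :
  prs (null_vector R r s i j) W = W 0 (lshift s i) - W 0 (rshift r j).
Proof.
rewrite /prs /null_vector; congr (_ - _).
  rewrite (bigD1 i) //= big1 => [|k nki]; rewrite !mxE !eqxx eq_lrshift /=.
    by rewrite !addr0 mul1r.
  by rewrite (inj_eq (@lshift_inj _ _)) (negPf nki) addr0 mul0r.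
rewrite (bigD1 j) //= big1 => [|k nkj]; rewrite !mxE !eqxx eq_rlshift /=.
  by rewrite addr0 add0r mul1r.
by rewrite (inj_eq (@rshift_inj _ _)) (negPf nkj) addr0 mul0r.
Qed.

Lemma null_vector_isotropic (R : realType) (r s : nat) (i : 'I_r) (j : 'I_s) :
  prs (null_vector R r s i j) (null_vector R r s i j) = 0.
Proof.
by rewrite prs_null_vector !mxE !eqxx eq_lrshift eq_rlshift addr0 add0r subrr.
Qed.

Lemma rep_isotropic_sq0 (R : realType) (r s : nat) (A : algType R)
    (iota : {linear 'rV[R]_(r + s) -> A}) (M : admissible_module iota)
    (Z : 'rV[R]_(r + s)) (v : M) :
  clifford_map iota -> prs Z Z = 0 ->
  am_rep M (iota Z) (am_rep M (iota Z) v) = 0.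
Proof.
move=> cliff Z0; have [_ JM] := am_repP M.
by rewrite -comp_lfunE -JM cliff Z0 oppr0 scale0r linear0 lfunE.
Qed.

(** Of [u] and [f u], for any nonzero [u], the last nonzero one is in the
kernel. *)
Lemma sq0_kernel_neq0 (K : fieldType) (V : vectType K) (f : 'End(V)) :
  (0 < \dim {:V})%N -> (forall v, f (f v) = 0) ->
  exists2 v, v != 0 & f v = 0.
Proof.
rewrite lt0n dimv_eq0 -vpick0; set u := vpick _ => u0 ff0.
by have [fu0|fu0] := eqVneq (f u) 0; [exists u | exists (f u)].
Qed.

Lemma rep_ker_ad_orthogonal (R : realType) (r s : nat) (A : algType R)
    (iota : {linear 'rV[R]_(r + s) -> A}) (M : admissible_module iota)
    (N : pseudoH_algebra M) (Z : 'rV[R]_(r + s)) (v w : M) :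
  am_rep M (iota Z) v = 0 -> prs Z (ph_ad N v w) = 0.
Proof. by move=> Jv0; rewrite /ph_ad /= -ph_bracketP Jv0 linear0l. Qed.

Theorem theorem7p6 (R : realType) (r s : nat) (hr : (1 <= r)%N) (hs : (1 <= s)%N)
    (Cl : algType R) (iota : {linear 'rV[R]_(r + s) -> Cl})
    (hCl : clifford_algebra iota)
    (M : admissible_module iota) (hM : minimal_admissible M)
    (N : pseudoH_algebra M) :
  ~ strongly_bracket_generating N.
Proof.
move=> sbg; have [cliff _] := hCl.
pose i := Ordinal hr; pose j := Ordinal hs; pose Z := null_vector R r s i j.
have [v v0 Jv0] : exists2 v : M, v != 0 & am_rep M (iota Z) v = 0.
  apply: sq0_kernel_neq0 (am_nonzero M) _ => v.
  exact: rep_isotropic_sq0 cliff (null_vector_isotropic _ _ _ _ _).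
(* The i-th basis vector is not orthogonal to Z, so it is not in the image of ad_v. *)
have [w adE] := sbg v v0 (delta_mx 0 (lshift s i)).
have := rep_ker_ad_orthogonal _ _ _ _ _ _ N Z v w Jv0.
rewrite adE prs_null_vector !mxE !eqxx eq_rlshift subr0.
by move/eqP; rewrite oner_eq0.
Qed.
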